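(* Let $\mathbb{G}=\mathbb{K}\ltimes\mathbb{H}$, where $\mathbb{H}$ is a locally compact abelian group and $\mathbb{K}$ is a finite abelian group acting on $\mathbb{H}$ via $\phi:\mathbb{K}\to\operatorname{Aut}(\mathbb{H})$, let $F\subset\widehat{\mathcal{S}}$ be a finite set, and let $\sigma:\mathbb{H}/\mathbb{K}\to\mathbb{H}$ be any section. With the notation of the context, the bijection $\mathcal{F}_{\mathrm{AP}}^{-1}:\mathbb{C}^{\mathbb{K}}\otimes\mathbb{C}^{\mathbb{K}}\otimes\mathbb{C}^F\to \mathrm{AP}_F(\mathbb{G})$ admits the decomposition $$\mathcal{F}_{\mathrm{AP}}^{-1}=\Xi^{-1}\circ(\mathrm{id}\otimes\mathcal{F}^*\otimes\mathrm{id})\circ\mathcal{P}_{\mathrm{Fun}(\mathbb{H}/\mathbb{K})}^{-1}\circ\mathcal{J}\circ\mathcal{P}_{\mathbb{C}^F}\circ(\mathrm{id}\otimes\mathcal{F}\otimes\mathrm{id}).$$ In particular, the generalized Fourier-Bessel operator $\mathcal{J}$ is a bijection onto its range.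
   Context: $\mathbb{K}$ is written multiplicatively, has cardinality $N$ and identity $e$; $\mathbb{H}$ is written additively; $\phi$ acts by topological automorphisms; the group law of $\mathbb{G}$ is $(k,x)(h,y)=(kh,x+\phi(k)y)$. $\widehat{\mathbb{H}}$ and $\widehat{\mathbb{K}}$ are the Pontryagin duals. $\mathbb{K}$ acts on $\widehat{\mathbb{H}}$ by $\phi(k)\lambda(x):=\lambda(\phi(k^{-1})x)$. $\widehat{\mathcal{S}}\subset\widehat{\mathbb{H}}$ is a fixed set containing exactly one representative of each $\mathbb{K}$-orbit in $\widehat{\mathbb{H}}$ having trivial stabilizer. For $\lambda\in\widehat{\mathcal{S}}$, $T^\lambda$ is the representation of $\mathbb{G}$ on $\mathbb{C}^{\mathbb{K}}$ given by $(T^\lambda(k,x)v)(h)=\phi(h)\lambda(x)\,v(k^{-1}h)$. Let $\{\delta_n\}_{n\in\mathbb{K}}$ be the canonical basis of $\mathbb{C}^{\mathbb{K}}$. $\mathrm{AP}_F(\mathbb{G})$ is the space of functions $f:\mathbb{G}\to\mathbb{C}$ of the form $f(g)=\sum_{\lambda\in F}\sum_{n,m\in\mathbb{K}}\langle T^\lambda(g)\delta_n,\delta_m\rangle a_{n,m}(\lambda)$ with $a_{n,m}:F\to\mathbb{C}$. The map $\mathcal{F}_{\mathrm{AP}}:\mathrm{AP}_F(\mathbb{G})\to\mathbb{C}^{\mathbb{K}}\otimes\mathbb{C}^{\mathbb{K}}\otimes\mathbb{C}^F$ is the linear bijection $f\mapsto\hat f$, where $\hat f(k,n,\lambda)=a_{n,nk}(\lambda)$;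 equivalently, its inverse sends $\hat f$ to $f(k,x)=\sum_{\lambda\in F}\sum_{n\in\mathbb{K}}\phi(nk)\lambda(x)\hat f(k,n,\lambda)$. A section is any map $\sigma:\mathbb{H}/\mathbb{K}\to\mathbb{H}$ (no regularity assumed) with $\sigma(y)$ belonging to the orbit $y$ for each $y\in\mathbb{H}/\mathbb{K}$. For $f:\mathbb{G}\to\mathbb{C}$, $\Xi f:\mathbb{K}\times\mathbb{K}\times\mathbb{H}/\mathbb{K}\to\mathbb{C}$ is $\Xi f(k,h,y)=f(k,\phi(h)\sigma(y))$; $\Xi$ is injective and $\Xi^{-1}$ denotes its inverse on its range. $\mathrm{Fun}(\mathbb{H}/\mathbb{K})$ is the space of complex-valued functions on $\mathbb{H}/\mathbb{K}$, and $a\otimes b\otimes\varphi\in\mathbb{C}^{\mathbb{K}}\otimes\mathbb{C}^{\mathbb{K}}\otimes\mathrm{Fun}(\mathbb{H}/\mathbb{K})$ is identified with the function $(k,h,y)\mapsto a_kb_h\varphi(y)$. The generalized Bessel function of parameter $\hat n\in\widehat{\mathbb{K}}$ is $J_{\hat n}(\lambda,y)=\sum_{r\in\mathbb{K}}\lambda(\phi(r)\sigma(y))\overline{\hat n(r)}$ for $\lambda\in\widehat{\mathcal{S}}$, $y\in\mathbb{H}/\mathbb{K}$. For $\varphi\in\mathbb{C}^F$, $\mathcal{J}_{\hat n}\varphi(y)=\sum_{\lambda\in F}J_{\hat n}(\lambda,y)\varphi(\lambda)$. The generalized Fourier-Bessel operator is $\mathcal{J}=\bigoplus_{k\in\mathbb{K},\hat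 n\in\widehat{\mathbb{K}}}\overline{\hat n(k)}\,\mathcal{J}_{\hat n}:\bigoplus_{k,\hat n}\mathbb{C}^F\to\bigoplus_{k,\hat n}\mathrm{Fun}(\mathbb{H}/\mathbb{K})$. $\mathcal{F}:\mathbb{C}^{\mathbb{K}}\to\mathbb{C}^{\widehat{\mathbb{K}}}$ is $\mathcal{F}v(\hat k)=\frac1{\sqrt N}\sum_{h\in\mathbb{K}}\overline{\hat k(h)}v(h)$, and $\mathcal{F}^*$ is its adjoint. For a vector space $V$, $\mathcal{P}_V:\mathbb{C}^{\mathbb{K}}\otimes\mathbb{C}^{\widehat{\mathbb{K}}}\otimes V\to\bigoplus_{k\in\mathbb{K},\hat n\in\widehat{\mathbb{K}}}V$ is the bijection $\mathcal{P}_V(a\otimes b\otimes v)=(a_kb_{\hat n}v)_{k,\hat n}$. *)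

(* Defs.v *)
From HB Require Import structures.
From mathcomp Require Import all_boot all_order all_algebra fingroup cyclic finmap.
From mathcomp Require Import complex.
From mathcomp Require Import all_classical all_reals all_analysis.
Set Implicit Arguments.
Unset Strict Implicit.
Unset Printing Implicit Defensive.
Import Order.TTheory GRing.Theory Num.Theory numFieldNormedType.Exports.
Local Open Scope classical_set_scope.
Local Open Scope ring_scope.

(* For finite I and J, the tensor product C^I (x) C^J (x) Fun(X) is the function
   space I * J * X -> R[i], a (x) b (x) f being the function tens a b f below. *)

(* R[i] carries a topology only through its numFieldType structure. *)
Definition Cfield (R : realType) : numFieldType := R[i].

Section Dual.
Context {R : realType} {H : topologicalZmodType}.

Record dual := Dual {
  dual_val :> H -> R[i];
  dualD : forall x y, dual_val (x + y) = dual_val x * dual_val y;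
  dual_norm : forall x, `|dual_val x| = 1;
  dual_continuous : continuous (dual_val : H -> Cfield R) }.

Lemma dual_ext (l m : dual) : l =1 m -> l = m.
Proof.
case: l m => l lD ln lc [m mD mn mc] /= /funext lm; subst m.
by congr Dual; exact: Prop_irrelevance.
Qed.

HB.instance Definition _ := gen_eqMixin dual.
HB.instance Definition _ := gen_choiceMixin dual.
End Dual.
Arguments dual R H : clear implicits.

(* K is finite, hence discrete: continuity of its characters is vacuous. *)
Definition is_fchar {R : realType} {K : finGroupType}
    (c : {ffun K -> R[i]}) : bool :=
  [forall x, forall y, c (x * y)%g == c x * c y] && [forall x, `|c x| == 1].

Definition fdual (R : realType) (K : finGroupType) :=
  {c : {ffun K -> R[i]} | is_fchar c}.

Definition fdual_fun {R : realType} {K : finGroupType} (c : fdual R K) :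
  K -> R[i] := val c.
Coercion fdual_fun : fdual >-> Funclass.

(* The dual of K is finite: characters take values in the #|K|-th roots of
   unity. *)
Section FdualFinite.
Context {R : realType} {K : finGroupType}.
Implicit Type c : fdual R K.

Lemma fdualM c x y : c (x * y)%g = c x * c y.
Proof. by have /andP[/forallP/(_ x)/forallP/(_ y)/eqP] := valP c. Qed.

Lemma fdual_norm c x : `|c x| = 1.
Proof. by have /andP[_ /forallP/(_ x)/eqP] := valP c. Qed.

Lemma fdual1 c : c 1%g = 1.
Proof.
have c1 : c 1%g != 0 by rewrite -normr_eq0 fdual_norm oner_neq0.
by apply: (mulfI c1); rewrite -fdualM mulg1 mulr1.
Qed.

Lemma fdualX c x n : c (x ^+ n)%g = c x ^+ n.
Proof.
elim: n => [|n IHn]; first by rewrite expg0 fdual1 expr0.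
by rewrite expgS fdualM IHn exprS.
Qed.

Let roots : seq R[i] :=
  sval (closed_field_poly_normal ('X^#|[set: K]%SET| - 1 : {poly R[i]})).

Lemma fdual_root c x : c x \in roots.
Proof.
rewrite /roots; case: closed_field_poly_normal => /= r rE.
have K0 : (0 < #|[set: K]%SET|)%N by exact: cardG_gt0.
have : root ('X^#|[set: K]%SET| - 1) (c x).
  rewrite rootE !hornerE -fdualX.
  by rewrite (expg_cardG (G := [set: K]%G) (finset.in_setT x)) fdual1 subrr.
rewrite rE rootZ ?root_prod_XsubC//.
by rewrite lead_coef_eq0 -size_poly_eq0 size_XnsubC.
Qed.

Let code c : {ffun K -> seq_sub roots} :=
  [ffun x => SeqSub (fdual_root c x)].

Let decode (f : {ffun K -> seq_sub roots}) : option (fdual R K) :=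
  insub [ffun x => val (f x)].

Fact fdual_pcancel : pcancel code decode.
Proof.
move=> c; rewrite /decode; have -> : [ffun x => val (code c x)] = val c.
  by apply/ffunP => x; rewrite !ffunE.
exact: valK.
Qed.

HB.instance Definition _ :=
  Finite.copy (fdual R K) (pcan_type fdual_pcancel).
End FdualFinite.

(* phi k is a homeomorphism, its inverse being phi k^-1. *)
Record topAction (K : finGroupType) (H : topologicalZmodType) := TopAction {
  topact :> K -> H -> H;
  topact1 : forall x, topact 1%g x = x;
  topactM : forall k h x, topact (k * h)%g x = topact k (topact h x);
  topactD : forall k x y, topact k (x + y) = topact k x + topact k y;
  topact_continuous : forall k, continuous (topact k) }.

(* phi is an argument of the type because the group law depends on it. *)
Definition sdprod {K : finGroupType} {H : topologicalZmodType}
  (phi : topAction K H) : Type := (K * H)%type.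

Section SemidirectProduct.
Context {K : finGroupType} {H : topologicalZmodType} (phi : topAction K H).
Local Notation G := (sdprod phi).

HB.instance Definition _ := Choice.copy G (K * H)%type.

Definition sdmul (g g' : G) : G := ((g.1 * g'.1)%g, g.2 + phi g.1 g'.2).
Definition sdone : G := (1%g, 0).
Definition sdinv (g : G) : G := (g.1^-1%g, - phi g.1^-1%g g.2).

Lemma topact0 k : phi k 0 = 0.
Proof. by apply: (addrI (phi k 0)); rewrite -topactD !addr0. Qed.

Fact sdmulA : associative sdmul.
Proof.
by move=> [k x] [h y] [l z]; rewrite /sdmul /= mulgA topactD topactM addrA.
Qed.
Fact sdmul1g : left_id sdone sdmul.
Proof. by move=> [k x]; rewrite /sdmul /= mul1g topact1 add0r. Qed.
Fact sdmulg1 : right_id sdone sdmul.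
Proof. by move=> [k x]; rewrite /sdmul /= mulg1 topact0 addr0. Qed.
Fact sdmulVg : left_inverse sdone sdinv sdmul.
Proof. by move=> [k x]; rewrite /sdmul /= mulVg addNr. Qed.
Fact sdmulgV : right_inverse sdone sdinv sdmul.
Proof.
move=> [k x]; rewrite /sdmul /sdinv /= mulgV; congr pair.
apply: (addIr (phi k (phi k^-1%g x))); rewrite -addrA -topactD addNr.
by rewrite topact0 addr0 -topactM mulgV topact1 add0r.
Qed.
HB.instance Definition _ :=
  isGroup.Build G sdmulA sdmul1g sdmulg1 sdmulVg sdmulgV.

Definition act_orbit (x : H) : set H := [set phi k x | k in [set: K]].

Definition orbit_space := {y : set H | exists x, y = act_orbit x}.

Definition is_section (sigma : orbit_space -> H) : Prop :=
  forall y, sval y (sigma y).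
End SemidirectProduct.

Section DualAction.
Context {R : realType} {K : finGroupType} {H : topologicalZmodType}.
Context (phi : topAction K H).

Section DualAct.
Context (k : K) (l : dual R H).
Let f (x : H) : R[i] := l (phi k^-1%g x).

Fact dual_actD x y : f (x + y) = f x * f y.
Proof. by rewrite /f topactD dualD. Qed.
Fact dual_act_norm x : `|f x| = 1.
Proof. exact: dual_norm. Qed.
Fact dual_act_continuous : continuous (f : H -> Cfield R).
Proof.
move=> x; apply: (@continuous_comp _ _ (Cfield R) (phi k^-1%g) l).
- exact: topact_continuous.
- exact: dual_continuous.
Qed.

Definition dual_act : dual R H :=
  @Dual R H (fun x => l (phi k^-1%g x))
    dual_actD dual_act_norm dual_act_continuous.
End DualAct.

Definition trivial_stabilizer (l : dual R H) : Prop :=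
  forall k, dual_act k l = l -> k = 1%g.

Definition is_free_transversal (S : set (dual R H)) : Prop :=
  S `<=` trivial_stabilizer /\
  (forall l, trivial_stabilizer l ->
    exists! m, S m /\ exists k, m = dual_act k l).
End DualAction.

Section Operators.
Context {R : realType}.
Local Notation C := (R[i]).

Definition inner {I : finType} (u v : I -> C) : C := \sum_i u i * (v i)^*.

Definition delta {I : finType} (n : I) : I -> C := fun i => (i == n)%:R.

Definition adjoint {I J : finType} (A : (I -> C) -> (J -> C)) :
    (J -> C) -> (I -> C) :=
  xget (fun _ _ => 0)
    [set B | forall v w, inner (A v) w = inner v (B w)].

Lemma adjointP (I J : finType) (A : (I -> C) -> (J -> C)) : linear A ->
  forall v w, inner (A v) w = inner v (adjoint A w).
Proof.
move=> Alin; suff ex : [set B | forall v w, inner (A v) w = inner v (B w)]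
    (fun w i => \sum_j w j * (A (delta i) j)^*).
  by have := xgetPex (fun _ _ => 0) (ex_intro _ _ ex); apply.
move=> v w /=.
have A0 : A 0 = 0.
  by have := Alin (-1) 0 0; rewrite scaler0 addr0 scaleN1r addNr.
have Asum (s : seq I) : A (\sum_(i <- s) v i *: (delta i : I -> C)) =
    \sum_(i <- s) v i *: A (delta i).
  elim: s => [|i s IHs]; first by rewrite !big_nil.
  by rewrite !big_cons Alin IHs.
have vE : v = \sum_i v i *: (delta i : I -> C).
  have scE j i : (v j *: (delta j : I -> C)) i = v j * delta j i by [].
  apply/funext => i; rewrite fct_sumE (bigD1 i)//= big1 ?addr0 => [|j ji].
    by rewrite scE /delta eqxx mulr1.
  by rewrite scE /delta eq_sym (negbTE ji) mulr0.
rewrite /inner {1}vE Asum.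
under eq_bigr do rewrite fct_sumE mulr_suml.
rewrite exchange_big/=; apply: eq_bigr => i _.
rewrite rmorph_sum mulr_sumr; apply: eq_bigr => j _.
by rewrite rmorphM /= conjCK -mulrA [in RHS](mulrC (w j)^* ).
Qed.

Lemma adjoint_unique (I J : finType) (A : (I -> C) -> (J -> C))
    (B : (J -> C) -> (I -> C)) : linear A ->
  (forall v w, inner (A v) w = inner v (B w)) -> B = adjoint A.
Proof.
move=> Alin AB; apply/funext => w; apply/funext => i.
have dE (u : I -> C) : inner (delta i) u = (u i)^*.
  rewrite /inner (bigD1 i)//= big1 ?addr0 /delta ?eqxx ?mul1r//.
  by move=> j /negbTE ->; rewrite mul0r.
by apply: (can_inj conjCK); rewrite -!dE -AB adjointP.
Qed.

Definition tens {I J X : Type} (a : I -> C) (b : J -> C) (f : X -> C) :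
  I * J * X -> C := fun p => a p.1.1 * b p.1.2 * f p.2.

(* id (x) A (x) id, for A linear; see id_tens_idE. *)
Definition id_tens_id {I J J' X : Type} (A : (J -> C) -> (J' -> C))
    (f : I * J * X -> C) : I * J' * X -> C :=
  fun p => A (fun j => f (p.1.1, j, p.2)) p.1.2.

Lemma id_tens_idE (I X : Type) (J J' : finType) (A : (J -> C) -> (J' -> C))
    (a : I -> C) (b : J -> C) (f : X -> C) : linear A ->
  id_tens_id A (tens a b f) = tens a (A b) f.
Proof.
move=> Alin; apply/funext => -[[i j] x]; rewrite /id_tens_id /tens /=.
have A0 : A 0 = 0.
  by have := Alin (-1) 0 0; rewrite scaler0 addr0 scaleN1r addNr.
have -> : (fun j => a i * b j * f x) = (a i * f x) *: b + 0.
  by apply/funext => k; rewrite addr0 mulrAC.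
by rewrite Alin A0 addr0 [LHS]mulrAC.
Qed.

(* a (x) b (x) v |-> (a_i b_j v)_(i, j) amounts to currying; see Pmap_tens. *)
Definition Pmap {I J X : Type} (f : I * J * X -> C) : I * J -> (X -> C) :=
  fun ij x => f (ij, x).

Definition Pmap_inv {I J X : Type} (u : I * J -> (X -> C)) : I * J * X -> C :=
  fun p => u p.1 p.2.

Lemma Pmap_tens (I J X : Type) (a : I -> C) (b : J -> C) (v : X -> C) i j :
  Pmap (tens a b v) (i, j) = (a i * b j) *: v.
Proof. by []. Qed.

Lemma PmapK (I J X : Type) : cancel (@Pmap I J X) Pmap_inv.
Proof. by move=> f; apply/funext => -[[]]. Qed.

Lemma Pmap_invK (I J X : Type) : cancel Pmap_inv (@Pmap I J X).
Proof. by move=> u; apply/funext => -[]. Qed.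

Definition fourier {K : finGroupType} (v : K -> C) : fdual R K -> C :=
  fun c => (sqrtC #|K|%:R)^-1 * \sum_(h : K) (c h)^* * v h.

Lemma fourier_linear (K : finGroupType) : linear (@fourier K).
Proof.
move=> a u v; apply/funext => c.
transitivity (a * fourier u c + fourier v c); last by [].
rewrite /fourier mulrCA -mulrDr [in RHS]mulr_sumr -big_split/=; congr (_ * _).
apply: eq_bigr => h _; transitivity ((c h)^* * (a * u h + v h)); first by [].
by rewrite mulrDr mulrCA.
Qed.
End Operators.

Section FourierBessel.
Context {R : realType} {K : finGroupType} {H : topologicalZmodType}.
Context (phi : topAction K H).
Local Notation C := (R[i]).
Local Notation G := (sdprod phi).

Definition Trep (l : dual R H) (g : G) (v : K -> C) : K -> C :=
  fun h => dual_act phi h l g.2 * v (g.1^-1 * h)%g.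

Lemma Trep1 l v : Trep l 1%g v = v.
Proof.
apply/funext => h; rewrite /Trep /= topact0 invg1 mul1g.
have l0 : l 0 != 0 by rewrite -normr_eq0 dual_norm oner_neq0.
suff -> : l 0 = 1 by rewrite mul1r.
by apply: (mulfI l0); rewrite -dualD addr0 mulr1.
Qed.

Lemma TrepM l g g' v : Trep l (g * g')%g v = Trep l g (Trep l g' v).
Proof.
apply/funext => h; rewrite /Trep /= topactD dualD -topactM !invMg invgK mulgA.
by rewrite mulrA.
Qed.

Context (F : {fset dual R H}).

Definition AP_sum (a : K -> K -> F -> C) : G -> C := fun g =>
  \sum_(l : F) \sum_(n : K) \sum_(m : K)
    inner (Trep (val l) g (delta n)) (delta m) * a n m l.

Definition AP : set (G -> C) := [set f | exists a, f = AP_sum a].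

(* The coefficients a of f are chosen; they are unique when F is contained
   in a free transversal. *)
Definition AP_coef (f : G -> C) : K -> K -> F -> C :=
  xget (fun _ _ _ => 0) [set a | f = AP_sum a].

Definition F_AP (f : G -> C) : K * K * F -> C :=
  fun p => AP_coef f p.1.2 (p.1.2 * p.1.1)%g p.2.

Definition F_AP_inv : (K * K * F -> C) -> (G -> C) :=
  'pinv_(fun _ _ => 0) AP F_AP.

Context (sigma : orbit_space phi -> H).

Definition Xi (f : G -> C) : K * K * orbit_space phi -> C :=
  fun p => f (p.1.1, phi p.1.2 (sigma p.2)).

(* Only meaningful on the range of Xi. *)
Definition Xi_inv : (K * K * orbit_space phi -> C) -> (G -> C) :=
  'pinv_(fun _ _ => 0) setT Xi.

Definition bessel (n : fdual R K) (l : dual R H) (y : orbit_space phi) : C :=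
  \sum_(r : K) l (phi r (sigma y)) * (n r)^*.

Definition bessel_op (n : fdual R K) (u : F -> C) : orbit_space phi -> C :=
  fun y => \sum_(l : F) bessel n (val l) y * u l.

Definition fourier_bessel (u : K * fdual R K -> (F -> C)) :
    K * fdual R K -> (orbit_space phi -> C) :=
  fun kn => (kn.2 kn.1)^* *: bessel_op kn.2 (u kn).
End FourierBessel.

Arguments AP_sum {R K H} phi F a g.
Arguments AP {R K H} phi F.
Arguments AP_coef {R K H} phi F f.
Arguments F_AP {R K H} phi F f.
Arguments F_AP_inv {R K H} phi F.
Arguments bessel_op {R K H} {phi} F sigma n u.
Arguments fourier_bessel {R K H} {phi} F sigma u.

(* Main.v *)
(* By the group law, almost periodic functions have the form
   f(k,x) = sum_(l,n) phi(nk)l(x) u(k,n,l). The characters phi(m)l, with m in K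
   and l in F, are pairwise distinct, since F consists of representatives of
   distinct free orbits; hence they are linearly independent, which makes F_AP a
   bijection. At x = phi(h)sigma(y) the sum over n is a convolution over K of
   r |-> l(phi(r)sigma(y)) with u(k,.,l), translated by k. The Fourier transform
   on K turns it into the product of a Bessel function and the Fourier transform
   of u, and turns the translation into multiplication by the conjugate of c(k),
   for c in the dual of K. The Fourier-Bessel operator is then injective, because
   the composite is and the Fourier transform on K is onto. *)
Require Import Defs.
From HB Require Import structures.
From mathcomp Require Import all_boot all_order all_algebra fingroup finmap.
From mathcomp Require Import cyclic pgroup mxrepresentation complex.
From mathcomp Require Import all_classical all_reals all_analysis ring.
Set Implicit Arguments.
Unset Strict Implicit.
Unset Printing Implicit Defensive.
Import Order.TTheory GRing.Theory Num.Theory numFieldNormedType.Exports.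
Local Open Scope classical_set_scope.
Local Open Scope ring_scope.

(** * Separation of points of a finite abelian group by characters *)

Lemma is_fcharM {R : realType} {K : finGroupType} (f : K -> R[i]) :
  f 1%g = 1 -> {morph f : x y / (x * y)%g >-> x * y} ->
  is_fchar [ffun x => f x].
Proof.
move=> f1 fM; apply/andP; split; apply/forallP => x.
  by apply/forallP => y; rewrite !ffunE fM.
have fX n : f (x ^+ n)%g = f x ^+ n.
  by elim: n => [|n IHn]; rewrite ?expg0 ?f1// expgS fM IHn exprS.
(* By Lagrange the values of [f] are roots of unity, so each modulus is a nonnegative real with a
   positive power equal to 1. *)
rewrite ffunE -(@pexpr_eq1 _ _ #|[set: K]%SET|) ?cardG_gt0// -normrX -fX.
by rewrite (expg_cardG (G := [set: K]%G) (finset.in_setT x)) f1 normr1.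
Qed.

(* The regular representation is faithful and is a direct sum of lines. *)
Lemma fdual_separates (R : realType) (K : finGroupType) (x : K) :
  abelian [set: K]%SET -> x != 1%g -> exists c : fdual R K, c x != 1.
Proof.
move=> K_abel x1; pose G := [set: K]%G; pose aG := regular_repr R[i] G.
have inG g : g \in G by exact: finset.in_setT.
have pG : ([pchar R[i]]^'.-group G)%g.
  apply/pgroupP => p pr_p _; apply/negP => /andP[_].
  by rewrite pnatr_eq0 => /eqP p0; rewrite p0 in pr_p.
have := mx_reducible_semisimple (mxmodule1 aG) (mx_Maschke_pchar aG pG).
(* Semisimplicity comes under [classically], so the goal is made boolean, which the finiteness of
   [fdual R K] allows. *)
move=> /(_ [exists c : fdual R K, c x != 1]) ss.
apply/existsP; apply: ss => -[I U W simU defW _].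
have [//|/existsPn noc] := boolP [exists c : fdual R K, c x != 1].
(* If all characters are 1 at [x], then [x] acts trivially on every line, hence on the whole space,
   against faithfulness. *)
suff ax : aG x = 1%:M.
  move: (mx_faithful_inj (regular_mx_faithful R[i] G) (inG x) (inG 1%g)).
  by rewrite repr_mx1 => /(_ ax) x1E; rewrite x1E eqxx in x1.
suff sub : (1%:M <= kermx (aG x - 1%:M))%MS.
  by apply/eqP; rewrite -subr_eq0 -[_ - _]mul1mx; apply/eqP/sub_kermxP.
rewrite -defW; apply/sumsmx_subP => i _.
have rU : \rank (U i) = 1%N.
  apply: (mxsimple_abelian_linear _ K_abel (simU i)).
  exact: group_closure_closed_field.
have [modU nzU _] := simU i; set v := nz_row (U i).
have nzv : v != 0 by rewrite nz_row_eq0.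
have defU : (U i <= v)%MS.
  by rewrite -(geq_leqif (mxrank_leqif_sup (nz_row_sub _))) rU rank_rV nzv.
have /rV0Pn[j nzvj] := nzv.
(* The line is spanned by [v], so [aG g] scales [v]; the scalar is read off at a nonzero
   coordinate. *)
pose f g := (v *m aG g) 0 j / v 0 j.
have vE g : v *m aG g = f g *: v.
  have /sub_rVP[a va] : (v *m aG g <= v)%MS.
    apply: submx_trans defU; apply: submx_trans (mxmoduleP modU g (inG g)).
    exact: submxMr (nz_row_sub _).
  by rewrite /f va mxE mulfK.
have f1 : f 1%g = 1 by rewrite /f repr_mx1 mulmx1 divff.
have fM : {morph f : g h / (g * h)%g >-> g * h}.
  move=> g h; rewrite {1}/f repr_mxM// mulmxA vE -scalemxAl vE scalerA.
  by rewrite mxE mulfK.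
have := noc (Sub _ (is_fcharM f1 fM)).
rewrite negbK /fdual_fun SubK ffunE => /eqP fx.
apply/sub_kermxP; apply/eqP; rewrite -submx0.
apply: submx_trans (submxMr _ defU) _.
by rewrite mulmxBr mulmx1 vE fx scale1r subrr sub0mx.
Qed.

(** * Orthogonality relations on K and on its dual *)

Lemma fdual_ext {R : realType} {K : finGroupType} (c d : fdual R K) :
  c =1 d -> c = d.
Proof. by move=> cd; apply/val_inj/ffunP. Qed.

(** Serves the vanishing character sums: translating the summation index multiplies the sum by some
    [z] other than 1. *)
Lemma fixed_scale0 (D : idomainType) (z s : D) : z != 1 -> s = z * s -> s = 0.
Proof.
move=> z1 /eqP; rewrite -subr_eq0 -{1}(mul1r s) -mulrBl mulf_eq0 subr_eq0.
by rewrite eq_sym (negbTE z1) => /eqP.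
Qed.

Section FiniteDual.
Context {R : realType} {K : finGroupType}.
Implicit Types c d : fdual R K.

Lemma fdualV c x : c x^-1%g = (c x)^*.
Proof.
have c0 : c x != 0 by rewrite -normr_eq0 fdual_norm oner_neq0.
by apply: (mulfI c0); rewrite -fdualM mulgV fdual1 -normCK fdual_norm expr1n.
Qed.

Lemma is_fchar1 : is_fchar ([ffun=> 1] : {ffun K -> R[i]}).
Proof. by apply: (@is_fcharM R K (fun=> 1)) => // x y; rewrite mul1r. Qed.

Definition fdual_one : fdual R K := Sub _ is_fchar1.

Lemma fdual_oneE x : fdual_one x = 1.
Proof. by rewrite /fdual_fun SubK ffunE. Qed.

Lemma is_fchar_mul c d : is_fchar [ffun x => c x * d x].
Proof.
apply: is_fcharM => [|x y]; first by rewrite !fdual1 mul1r.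
by rewrite !fdualM mulrACA.
Qed.

Definition fdual_mul c d : fdual R K := Sub _ (is_fchar_mul c d).

Lemma fdual_mulE c d x : fdual_mul c d x = c x * d x.
Proof. by rewrite /fdual_fun SubK ffunE. Qed.

Lemma fdual_mul_inj c : injective (fdual_mul c).
Proof.
move=> d e de; apply: fdual_ext => x.
have c0 : c x != 0 by rewrite -normr_eq0 fdual_norm oner_neq0.
by apply: (mulfI c0); rewrite -!fdual_mulE de.
Qed.

Lemma fdual_ortho c d :
  \sum_(x : K) (c x)^* * d x = #|K|%:R * (c == d)%:R.
Proof.
have [->|cd] := eqVneq c d.
  rewrite mulr1 (eq_bigr (fun=> 1)) ?sumr_const//.
  by move=> x _; rewrite mulrC -normCK fdual_norm expr1n.
rewrite mulr0.
have [y cdy] : exists y, c y != d y.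
  apply/existsP; apply: contraNT cd => /existsPn cdE.
  by apply/eqP/fdual_ext => y; apply/eqP/negbNE/cdE.
apply: (@fixed_scale0 _ ((c y)^* * d y)).
  apply: contra cdy => /eqP cd1; apply/eqP.
  by rewrite -[LHS]mulr1 -cd1 mulrA -normCK fdual_norm expr1n mul1r.
rewrite mulr_sumr [LHS](reindex_inj (mulgI y)); apply: eq_bigr => x _.
by rewrite !fdualM rmorphM mulrACA.
Qed.

Hypothesis K_abel : abelian [set: K]%SET.

Lemma sum_fdual0 (x : K) : x != 1%g -> \sum_(c : fdual R K) c x = 0.
Proof.
move=> x1; have [d dx] := fdual_separates R K_abel x1.
apply: (fixed_scale0 dx).
rewrite mulr_sumr [LHS](reindex_inj (@fdual_mul_inj d)); apply: eq_bigr => c _.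
exact: fdual_mulE.
Qed.

(** Double counting of the sum of all [c x]: summing over [c] first leaves only x = 1, summing over
    [x] first leaves only the trivial character. *)
Lemma card_fdual : #|{: fdual R K}|%:R = #|K|%:R :> R[i].
Proof.
transitivity (\sum_(c : fdual R K) \sum_(x : K) c x).
  rewrite exchange_big (bigD1 1%g)//= [X in _ + X]big1 ?addr0.
    by rewrite (eq_bigr (fun=> 1)) ?sumr_const// => c _; rewrite fdual1.
  by move=> x; exact: sum_fdual0.
transitivity (\sum_(c : fdual R K) #|K|%:R * (fdual_one == c)%:R : R[i]).
  apply: eq_bigr => c _; rewrite -fdual_ortho; apply: eq_bigr => x _.
  by rewrite fdual_oneE rmorph1 mul1r.
by rewrite (bigD1 fdual_one)//= eqxx mulr1 big1 ?addr0// => c;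
  rewrite eq_sym => /negbTE->; rewrite mulr0.
Qed.

Lemma sum_fdual (x : K) :
  \sum_(c : fdual R K) c x = #|K|%:R * (x == 1%g)%:R.
Proof.
have [->|x1] := eqVneq x 1%g; last by rewrite mulr0 sum_fdual0.
rewrite mulr1 -card_fdual (eq_bigr (fun=> 1)) ?sumr_const// => c _.
exact: fdual1.
Qed.
End FiniteDual.

(** * The Fourier transform on K and its adjoint *)

Section FiniteFourier.
Context {R : realType} {K : finGroupType}.
Local Notation C := R[i].

(** The conjugate transpose of the kernel satisfies the defining identity of the chosen [adjoint],
    which is unique; the normalization is real. *)
Lemma adjoint_fourier (w : fdual R K -> C) (h : K) :
  adjoint (@fourier R K) w h =
  (sqrtC #|K|%:R)^-1 * \sum_(c : fdual R K) c h * w c.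
Proof.
have s_real : ((sqrtC #|K|%:R)^-1 : C)^* = (sqrtC #|K|%:R)^-1.
  by rewrite geC0_conj// invr_ge0 sqrtC_ge0.
suff /(adjoint_unique (@fourier_linear R K)) <- : forall v w,
    inner (@fourier R K v) w =
    inner v (fun h : K =>
      (sqrtC #|K|%:R)^-1 * \sum_(c : fdual R K) c h * w c) by [].
move=> {}v {}w; rewrite /inner.
transitivity (\sum_(c : fdual R K) \sum_(x : K)
    (sqrtC #|K|%:R)^-1 * ((c x)^* * v x * (w c)^*)).
  by apply: eq_bigr => c _; rewrite /fourier -mulrA mulr_suml mulr_sumr.
rewrite exchange_big; apply: eq_bigr => x _.
rewrite rmorphM/= s_real -mulr_sumr mulrCA; congr (_ * _).
rewrite rmorph_sum mulr_sumr; apply: eq_bigr => c _.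
by rewrite rmorphM/= mulrA (mulrC (v x)).
Qed.

Lemma sqrt_card_sq : (sqrtC #|K|%:R)^-1 * (sqrtC #|K|%:R)^-1 * #|K|%:R = 1 :> C.
Proof.
have K0 : #|K|%:R != 0 :> C.
  by rewrite pnatr_eq0 -lt0n; apply/card_gt0P; exists 1%g.
by rewrite -invfM -expr2 sqrtCK mulVf.
Qed.

(** Follows from orthogonality of characters, and makes [fourier] onto, as the injectivity of the
    Fourier-Bessel operator requires. *)
Lemma adjoint_fourierK : cancel (adjoint (@fourier R K)) (@fourier R K).
Proof.
move=> w; apply/funext => /= c; rewrite /fourier.
transitivity ((sqrtC #|K|%:R)^-1 * (sqrtC #|K|%:R)^-1 *
    \sum_(d : fdual R K) (\sum_(x : K) (c x)^* * d x) * w d).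
  rewrite -mulrA; congr (_ * _); rewrite mulr_sumr.
  under [RHS]eq_bigr do rewrite mulr_suml mulr_sumr.
  rewrite [RHS]exchange_big; apply: eq_bigr => x _.
  rewrite adjoint_fourier mulrCA mulr_sumr mulr_sumr; apply: eq_bigr => d _.
  by ring.
rewrite (bigD1 c)//= [X in _ + X]big1 ?addr0 => [|d dc]; rewrite fdual_ortho.
  by rewrite eqxx mulr1 mulrA sqrt_card_sq mul1r.
by rewrite eq_sym (negbTE dc) mulr0 mul0r.
Qed.

(** After expansion, the sum over [c] of c((n k r)^-1 h) is concentrated at r = (n k)^-1 h. The
    transform of [a] is unnormalized, so the two factors from [fourier] and its adjoint exactly
    cancel [#|K|]. *)
Lemma adjoint_fourier_convolution (a b : K -> C) (k h : K) :
  abelian [set: K]%SET ->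
  adjoint (@fourier R K)
    (fun c : fdual R K => (c k)^* * ((\sum_r a r * (c r)^*) * fourier b c)) h =
  \sum_n a ((n * k)^-1 * h)%g * b n.
Proof.
move=> K_abel; rewrite adjoint_fourier.
transitivity (\sum_(n : K) \sum_(r : K)
    (sqrtC #|K|%:R)^-1 * (sqrtC #|K|%:R)^-1 *
    (\sum_(c : fdual R K) c ((n * k * r)^-1 * h)%g) * (a r * b n)).
  rewrite mulr_sumr.
  under [RHS]eq_bigr do under eq_bigr do rewrite mulr_sumr mulr_suml.
  under [RHS]eq_bigr do rewrite exchange_big.
  rewrite [RHS]exchange_big; apply: eq_bigr => c _.
  rewrite [RHS]exchange_big /fourier mulr_suml 3!mulr_sumr.
  apply: eq_bigr => r _; rewrite !mulr_sumr; apply: eq_bigr => n _.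
  by rewrite fdualM fdualV !fdualM !rmorphM/=; ring.
apply: eq_bigr => n _.
rewrite (bigD1 ((n * k)^-1 * h)%g)//= [X in _ + X]big1 ?addr0 => [|r rE];
  rewrite (sum_fdual K_abel).
  by rewrite mulgA mulgV mul1g mulVg eqxx mulr1 sqrt_card_sq mul1r.
suff /negbTE-> : ((n * k * r)^-1 * h)%g != 1%g by rewrite !mulr0 mul0r.
apply: contra rE => /eqP e; apply/eqP.
have -> : h = (n * k * r)%g by rewrite -[RHS]mulg1 -e mulKVg.
by rewrite mulKg.
Qed.
End FiniteFourier.

(** * Linear independence of the characters of H *)

Section DualIndependence.
Context {R : realType} {H : topologicalZmodType}.
Implicit Types l m : dual R H.

Lemma dual_neq0 l x : l x != 0.
Proof. by rewrite -normr_eq0 dual_norm oner_neq0. Qed.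

(* Dedekind: comparing the relation at x + y with m(y) times the relation at x
   eliminates m. *)
Lemma dual_independent (I : eqType) (chi : I -> dual R H) (s : seq I)
    (a : I -> R[i]) :
  injective chi -> uniq s -> (forall x, \sum_(i <- s) a i * chi i x = 0) ->
  {in s, forall i, a i = 0}.
Proof.
move=> chi_inj; elim: s a => [|j s IHs] a //= /andP[js us] rel.
have as0 : {in s, forall i, a i = 0}.
  move=> i si; have ij : chi i <> chi j.
    by move=> /chi_inj ij; rewrite -ij si in js.
  have [y ijy] : exists y, chi i y != chi j y.
    apply: contrapT => /forallNP ijE; apply/ij/dual_ext => y.
    by apply: contrapT => /eqP/ijE.
  have /(IHs _ us)/(_ _ si)/eqP : forall x,
      \sum_(i <- s) (a i * (chi i y - chi j y)) * chi i x = 0.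
    move=> x; transitivity (\sum_(k <- j :: s) a k * chi k (x + y) -
        chi j y * \sum_(k <- j :: s) a k * chi k x);
      last by rewrite !rel mulr0 subrr.
    rewrite mulr_sumr -sumrB big_cons -[LHS]add0r; congr (_ + _).
      by rewrite dualD; ring.
    by apply: eq_bigr => k _; rewrite dualD; ring.
  by rewrite mulf_eq0 subr_eq0 (negbTE ijy) orbF => /eqP.
move=> i; rewrite inE => /orP[/eqP->|]; last exact: as0.
have := rel 0; rewrite big_cons big1_seq ?addr0 => [/eqP|k /andP[_ /as0->]].
  by rewrite mulf_eq0 (negbTE (dual_neq0 _ _)) orbF => /eqP.
by rewrite mul0r.
Qed.
End DualIndependence.

(** * Almost periodic functions, their coefficients, and restriction along a section *)

Section AlmostPeriodic.
Context {R : realType} {K : finGroupType} {H : topologicalZmodType}.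
Context (phi : topAction K H).
Local Notation C := R[i].

Lemma dual_actM k h (l : dual R H) :
  dual_act phi (k * h)%g l = dual_act phi k (dual_act phi h l).
Proof. by apply: dual_ext => x /=; rewrite invMg topactM. Qed.

Lemma dual_act1 (l : dual R H) : dual_act phi 1%g l = l.
Proof. by apply: dual_ext => x /=; rewrite invg1 topact1. Qed.

(** T(k,x) sends [delta n] to a multiple of [delta (k * n)], so only m = k n survives. *)
Lemma AP_sumE (F : {fset dual R H}) (a : K -> K -> F -> C) (g : sdprod phi) :
  AP_sum phi F a g =
  \sum_(l : F) \sum_(n : K)
    dual_act phi (g.1 * n)%g (val l) g.2 * a n (g.1 * n)%g l.
Proof.
apply: eq_bigr => l _; apply: eq_bigr => n _.
rewrite (bigD1 (g.1 * n)%g)//= [X in _ + X]big1 ?addr0 => [|m mE].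
  rewrite /inner (bigD1 (g.1 * n)%g)//= [X in _ + X]big1 ?addr0 => [|i iE].
    by rewrite /Trep /delta !eqxx mulKg eqxx conjC1 !mulr1.
  by rewrite /delta (negbTE iE) rmorph0 mulr0.
rewrite /inner big1 ?mul0r// => i _; rewrite /Trep /delta.
have [iE|_] := eqVneq i m; last by rewrite rmorph0 mulr0.
suff /negbTE-> : (g.1^-1 * i)%g != n by rewrite mulr0 mul0r.
by apply: contra mE => /eqP <-; rewrite iE mulKVg.
Qed.

Section FreeOrbits.
Context (Shat : set (dual R H)) (S_transv : is_free_transversal phi Shat).
Context (F : {fset dual R H}) (F_sub : [set` F] `<=` Shat).

(** Equal images put both representatives in one orbit, so they coincide; the trivial stabilizer
    then equates the group elements. *)
Lemma dual_act_transversal_inj :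
  injective (fun p : K * F => dual_act phi p.1 (val p.2)).
Proof.
have [S_free S_uniq] := S_transv.
have FS (l : F) : Shat (val l) by apply: F_sub; exact: (valP l).
move=> [k l] [h m] /= E.
have mE : val m = dual_act phi (h^-1 * k)%g (val l).
  by rewrite dual_actM E -dual_actM mulVg dual_act1.
have [z [_ zU]] := S_uniq _ (S_free _ (FS l)).
have lm : val l = val m.
  rewrite -(zU (val l)); last by split=> //; exists 1%g; rewrite dual_act1.
  by apply: zU; split=> //; exists (h^-1 * k)%g.
congr pair; last exact: val_inj.
by apply/esym/eqP; rewrite eq_mulVg1; apply/eqP/(S_free _ (FS l)); rewrite -mE.
Qed.

(** For fixed k, the sum is a combination in x of the distinct characters phi(k n)l with
    coefficients [a n (k * n) l]. Independence recovers these, and k = m n^-1 reaches the entry (n,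
    m). *)
Lemma AP_sum_inj : injective (@AP_sum R K H phi F).
Proof.
move=> a b ab; apply/funext => n; apply/funext => m; apply/funext => l.
pose k := (m * n^-1)%g; apply/eqP; rewrite -subr_eq0; apply/eqP.
pose d (p : K * F) := a (k^-1 * p.1)%g p.1 p.2 - b (k^-1 * p.1)%g p.1 p.2.
have := @dual_independent _ _ _ _ (index_enum _) d dual_act_transversal_inj.
move=> /(_ (index_enum_uniq _)) d0.
have -> : n = (k^-1 * m)%g by rewrite /k invMg invgK mulgKV.
apply: (d0 _ (m, l)); last exact: mem_index_enum.
move=> x; have /eqP := congr1 (fun f => f ((k, x) : sdprod phi)) ab.
rewrite !AP_sumE -subr_eq0 -sumrB /= => /eqP ab0; rewrite -[RHS]ab0.
transitivity (\sum_(l : F) \sum_(n : K) d (n, l) * dual_act phi n (val l) x).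
  by rewrite [RHS]exchange_big pair_bigA; apply: eq_bigr => -[].
apply: eq_bigr => j _; rewrite -sumrB (reindex_inj (mulgI k)).
by apply: eq_bigr => i _; rewrite /d /= mulKg; ring.
Qed.

Lemma AP_coefK a : AP_coef phi F (AP_sum phi F a) = a.
Proof. by apply: xget_unique => // b /AP_sum_inj. Qed.

Lemma F_AP_sum a p :
  F_AP phi F (AP_sum phi F a) p = a p.1.2 (p.1.2 * p.1.1)%g p.2.
Proof. by rewrite /F_AP AP_coefK. Qed.

Lemma F_AP_bij : set_bij (AP phi F) setT (F_AP phi F).
Proof.
split=> // [f g|u _].
  rewrite !inE => -[a ->] [b ->] ab; congr AP_sum.
  apply/funext => n; apply/funext => m; apply/funext => l.
  (* The index n^-1 m solves m = n k for k; the same substitution gives the preimage for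
     surjectivity. *)
  have := congr1 (fun u => u ((n^-1 * m)%g, n, l)) ab.
  by rewrite !F_AP_sum /= !mulKVg.
exists (AP_sum phi F (fun n m l => u ((n^-1 * m)%g, n, l))); first by eexists.
by apply/funext => -[[k n] l]; rewrite F_AP_sum /= mulKg.
Qed.

(** [F_AP] reads the entry (n, n k), whereas the representation produces (n, k n); commutativity of
    K reconciles them. *)
Lemma F_AP_invE (u : K * K * F -> C) : abelian [set: K]%SET ->
  F_AP_inv phi F u = (fun g : sdprod phi => \sum_(l : F) \sum_(n : K)
    dual_act phi (n * g.1)%g (val l) g.2 * u (g.1, n, l)).
Proof.
move=> K_abel; have mulgC (x y : K) : (x * y = y * x)%g.
  by apply: (centsP K_abel); exact: finset.in_setT.
have [_ F_inj _] := F_AP_bij.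
pose a n m (l : F) := u ((n^-1 * m)%g, n, l).
have <- : F_AP phi F (AP_sum phi F a) = u.
  by apply/funext => -[[k n] l]; rewrite F_AP_sum /a /= mulKg.
rewrite /F_AP_inv pinvKV//; last by rewrite inE; exists a.
apply/funext => g; rewrite AP_sumE; apply: eq_bigr => l _; apply: eq_bigr => n _.
by rewrite F_AP_sum /= mulgC.
Qed.
End FreeOrbits.

(** Each x is phi(h^-1) of the point chosen in its orbit, so [Xi f] records every value of [f]. *)
Lemma Xi_inj (sigma : orbit_space phi -> H) : is_section sigma ->
  injective (@Xi R K H phi sigma).
Proof.
move=> sigma_sec f g fg; apply/funext => -[k x].
have [h _ hx] := sigma_sec (exist _ (act_orbit phi x) (ex_intro _ x erefl)).
have -> : x = phi h^-1%g (phi h x) by rewrite -topactM mulVg topact1.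
by rewrite hx; exact: (congr1 (fun u => u (k, h^-1%g, _)) fg).
Qed.

Lemma Xi_invK (sigma : orbit_space phi -> H) : is_section sigma ->
  cancel (@Xi R K H phi sigma) (Xi_inv sigma).
Proof.
move=> sigma_sec f; rewrite /Xi_inv pinvKV ?in_setT//.
by move=> ? ? _ _; exact: Xi_inj.
Qed.
End AlmostPeriodic.

(** * Factorization through the Fourier-Bessel operator *)

Theorem theorem2 (R : realType) (H : topologicalZmodType)
    (H_lc : locally_compact [set: H]) (H_haus : hausdorff_space H)
    (K : finGroupType) (K_abel : abelian [set: K]%SET) (phi : topAction K H)
    (Shat : set (dual R H)) (S_transv : is_free_transversal phi Shat)
    (F : {fset dual R H}) (F_sub : [set` F] `<=` Shat)
    (sigma : orbit_space phi -> H) (sigma_sec : is_section sigma) :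
  let decomp : (K * K * F -> R[i]) -> (K * K * orbit_space phi -> R[i]) :=
    id_tens_id (adjoint (@fourier R K)) \o Pmap_inv \o fourier_bessel F sigma
      \o Pmap \o id_tens_id (@fourier R K) in
  [/\ set_bij (AP phi F) setT (F_AP phi F),
      range decomp `<=` range (Xi sigma),
      F_AP_inv phi F = Xi_inv sigma \o decomp &
      set_bij setT (range (fourier_bessel F sigma)) (fourier_bessel F sigma)].
Proof.
move=> decomp.
(* This form also shows that [decomp] lands in the range of [Xi], where [Xi_inv] is a true
   inverse. *)
have decompE u : decomp u = Xi sigma (F_AP_inv phi F u).
  apply/funext => -[[k h] y]; rewrite (F_AP_invE S_transv F_sub u K_abel) /Xi /=.
  transitivity (adjoint (@fourier R K) (fun c : fdual R K =>
      \sum_(l : F) (c k)^* * ((\sum_r val l (phi r (sigma y)) * (c r)^*) *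
                              fourier (fun n => u (k, n, l)) c)) h).
    by congr (adjoint _ _ h); apply/funext => c; rewrite -mulr_sumr.
  (* The adjoint is unfolded to pull the sum over [l] out of it, then folded back for each [l]. *)
  rewrite adjoint_fourier.
  under [X in _ * X]eq_bigr do rewrite mulr_sumr.
  rewrite [in LHS]exchange_big mulr_sumr; apply: eq_bigr => l _.
  rewrite -adjoint_fourier.
  (* The convolution evaluates l at phi((n k)^-1 h)sigma(y), which is the value of phi(n k)l at
     phi(h)sigma(y). *)
  rewrite (adjoint_fourier_convolution (fun r => val l (phi r (sigma y))))//.
  by apply: eq_bigr => n _; rewrite topactM.
have bij := F_AP_bij S_transv F_sub.
have F_AP_inv_inj : injective (F_AP_inv phi F).
  have [_ _ surj] := bij.
  by move=> u v; apply: (surjpinv_inj surj); exact: in_setT.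
split=> //.
- by move=> _ [u _ <-]; rewrite decompE; exists (F_AP_inv phi F u).
- by apply/funext => u; rewrite /= decompE Xi_invK.
split=> [u _|u v _ _ uv|_ [u _ <-]]; [by exists u| |by exists u].
(* [B] is a right inverse of the steps of [decomp] preceding [fourier_bessel]. Hence equal values of
   [fourier_bessel] at [u] and [v] give equal values of [decomp] at [B u] and [B v], and [decomp] is
   injective. *)
pose B (w : K * fdual R K -> F -> R[i]) :=
  id_tens_id (adjoint (@fourier R K)) (Pmap_inv w).
have BK w : Pmap (id_tens_id (@fourier R K) (B w)) = w.
  apply/funext => -[k c]; apply/funext => l.
  by rewrite /Pmap /id_tens_id /= (adjoint_fourierK (fun c => w (k, c) l)).
have decompB w : decomp (B w) =
    id_tens_id (adjoint (@fourier R K)) (Pmap_inv (fourier_bessel F sigma w)).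
  by rewrite /decomp /= BK.
rewrite -(BK u) -(BK v); congr (Pmap (id_tens_id _ _)).
apply: F_AP_inv_inj; apply: (Xi_inj sigma_sec).
by rewrite -!decompE !decompB uv.
Qed.
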